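(* Let $(\boldsymbol{Z}_k)_{k\in\mathbb{Z}_+}$ be a multitype branching process with random migration (MBPM), and let $\mathcal{F}_k=\sigma(\boldsymbol{Z}_0,\ldots,\boldsymbol{Z}_k)$, $k\in\mathbb{Z}_+$. Then, for each $k\in\mathbb{N}$, almost surely, $$\operatorname{E}[\boldsymbol{Z}_k\mid\mathcal{F}_{k-1}]=\mathsf{m}\,(\boldsymbol{Z}_{k-1}+\boldsymbol{h}(\boldsymbol{Z}_{k-1})),$$ $$\operatorname{Var}[\boldsymbol{Z}_k\mid\mathcal{F}_{k-1}]=(\boldsymbol{Z}_{k-1}+\boldsymbol{h}(\boldsymbol{Z}_{k-1}))\odot\boldsymbol{\mathsf{\Sigma}}+\mathsf{m}\,V(\boldsymbol{Z}_{k-1})\,\mathsf{m}^\top,$$ where $V(\boldsymbol{z})=\operatorname{Var}[\boldsymbol{M}_0(\boldsymbol{z})]$ for $\boldsymbol{z}\in\mathbb{Z}_+^p$.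
   Context: Model (MBPM). $\mathbb{N}$ denotes the positive integers and $\mathbb{Z}_+$ the non-negative integers. Fix $p\in\mathbb{N}$ and a probability space on which all random vectors are defined. - Offspring: $\boldsymbol{X}_{k,j,i}=(X_{k,j,i,1},\ldots,X_{k,j,i,p})^\top$, $k\in\mathbb{Z}_+$, $j\in\mathbb{N}$, $i\in\{1,\ldots,p\}$, are independent $\mathbb{Z}_+^p$-valued random vectors, identically distributed in $(k,j)$ for each fixed $i$. - Emigration: for each $\boldsymbol{z}\in\mathbb{Z}_+^p$, $\boldsymbol{D}_k(\boldsymbol{z})=(D_{k,1}(\boldsymbol{z}),\ldots,D_{k,p}(\boldsymbol{z}))^\top$, $k\in\mathbb{Z}_+$, are identically distributed $\mathbb{Z}_+^p$-valued random vectors with $D_{k,i}(\boldsymbol{z})=0$ if $z_i=0$ and $D_{k,i}(\boldsymbol{z})\in[1,z_i]$ if $z_i>0$. - Immigration: for each $\boldsymbol{z}\in\mathbb{Z}_+^p$, $\boldsymbol{I}_k(\boldsymbol{z})=(I_{k,1}(\boldsymbol{z}),\ldots,I_{k,p}(\boldsymbol{z}))^\top$, $k\in\mathbb{Z}_+$, are identically distributed $\mathbb{N}^p$-valued random vectors. - Migration: for each $\boldsymbol{z}\in\mathbb{Z}_+^p$, $\boldsymbol{M}_k(\boldsymbol{z})=(M_{k,1}(\boldsymbol{z}),\ldots,M_{k,p}(\boldsymbol{z}))^\top$, $k\in\mathbb{Z}_+$, are identically distributed $\mathbb{Z}^p$-valued random vectors with range contained in $[-z_1,\infty)\times\cdots\times[-z_p,\infty)$,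 where $M_{k,i}(\boldsymbol{z})$ equals $0$ with probability $p_i(\boldsymbol{z})$, $I_{k,i}(\boldsymbol{z})$ with probability $q_i(\boldsymbol{z})$, and $-D_{k,i}(\boldsymbol{z})$ with probability $r_i(\boldsymbol{z})$ (so the law of $M_{k,i}(\boldsymbol{z})$ is the corresponding mixture of the laws of $0$, $I_{k,i}(\boldsymbol{z})$, $-D_{k,i}(\boldsymbol{z})$). Here $p_i(\boldsymbol{z}),q_i(\boldsymbol{z}),r_i(\boldsymbol{z})\in[0,1]$, $p_i(\boldsymbol{z})+q_i(\boldsymbol{z})+r_i(\boldsymbol{z})=1$, and $r_i(\boldsymbol{z})=0$ if $z_i=0$. - $\boldsymbol{Z}_0$ is a $\mathbb{Z}_+^p$-valued random vector, and the random vectors $\boldsymbol{Z}_0,\ \boldsymbol{X}_{k,j,i},\ \boldsymbol{M}_k(\boldsymbol{z})$ ($k\in\mathbb{Z}_+$, $j\in\mathbb{N}$, $1\le i\le p$, $\boldsymbol{z}\in\mathbb{Z}_+^p$) are independent. - The MBPM is defined recursively by $\boldsymbol{Z}_{k+1}=\sum_{i=1}^p\sum_{j=1}^{Z_{k,i}+M_{k,i}(\boldsymbol{Z}_k)}\boldsymbol{X}_{k,j,i}$, $k\in\mathbb{Z}_+$ (empty sums are $\boldsymbol 0$). Moments (assumed finite, including second moments of $\boldsymbol{X}_{0,1,i}$ and $\boldsymbol{M}_0(\boldsymbol{z})$): $\boldsymbol{m}_i=\operatorname{E}[\boldsymbol{X}_{0,1,i}]$; $\mathsf{m}=(\boldsymbol{m}_1,\ldots,\boldsymbol{m}_p)\in\mathbb{R}_+^{p\times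 p}$ (the matrix with columns $\boldsymbol{m}_i$); $\mathsf{\Sigma}_i=\operatorname{Var}[\boldsymbol{X}_{0,1,i}]$ (covariance matrix); $\boldsymbol{\mathsf{\Sigma}}=(\mathsf{\Sigma}_1,\ldots,\mathsf{\Sigma}_p)$; $a_i(\boldsymbol{z})=\operatorname{E}[I_{0,i}(\boldsymbol{z})]$; $b_i(\boldsymbol{z})=\operatorname{E}[D_{0,i}(\boldsymbol{z})]$; $\boldsymbol{h}(\boldsymbol{z})=(h_1(\boldsymbol{z}),\ldots,h_p(\boldsymbol{z}))^\top=\operatorname{E}[\boldsymbol{M}_0(\boldsymbol{z})]$, i.e. $h_i(\boldsymbol{z})=a_i(\boldsymbol{z})q_i(\boldsymbol{z})-b_i(\boldsymbol{z})r_i(\boldsymbol{z})$. Notation: for $\boldsymbol{z}\in\mathbb{R}^p$ and $\boldsymbol{\mathsf{A}}=(\mathsf{A}_1,\ldots,\mathsf{A}_p)\in(\mathbb{R}^{p\times p})^p$, $\boldsymbol{z}\odot\boldsymbol{\mathsf{A}}=\sum_{i=1}^p z_i\mathsf{A}_i$. $\operatorname{Var}$ of a random vector is its covariance matrix, and conditional moments given $\mathcal{F}_{k-1}$ are understood as the moments of the conditional distribution of $\boldsymbol{Z}_k$ given $\mathcal{F}_{k-1}$. *)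

(* Defs.v *)
From HB Require Import structures.
From mathcomp Require Import all_boot all_order all_algebra.
From mathcomp Require Import all_classical all_reals all_analysis.
From mathcomp Require Import measurable_realfun.
Set Implicit Arguments.
Unset Strict Implicit.
Unset Printing Implicit Defensive.
Import Order.TTheory GRing.Theory Num.Theory.
Import numFieldNormedType.Exports.
Local Open Scope classical_set_scope.
Local Open Scope ring_scope.

(* Aliases of 'cV[nat]_p and 'cV[int]_p carrying the discrete sigma-algebra. *)
Definition nvec (p : nat) : Type := 'cV[nat]_p.
Definition zvec (p : nat) : Type := 'cV[int]_p.

HB.instance Definition _ (p : nat) := Countable.copy (nvec p) 'cV[nat]_p.
HB.instance Definition _ (p : nat) := GRing.Nmodule.copy (nvec p) 'cV[nat]_p.
HB.instance Definition _ (p : nat) :=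
  isPointed.Build (nvec p) (0 : 'cV[nat]_p).
HB.instance Definition _ (p : nat) := @isMeasurable.Build
  default_measure_display (nvec p) discrete_measurable discrete_measurable0
  discrete_measurableC discrete_measurableU.

HB.instance Definition _ (p : nat) := Countable.copy (zvec p) 'cV[int]_p.
HB.instance Definition _ (p : nat) := GRing.Zmodule.copy (zvec p) 'cV[int]_p.
HB.instance Definition _ (p : nat) :=
  isPointed.Build (zvec p) (0 : 'cV[int]_p).
HB.instance Definition _ (p : nat) := @isMeasurable.Build
  default_measure_display (zvec p) discrete_measurable discrete_measurable0
  discrete_measurableC discrete_measurableU.

Definition nvecR (R : realType) (p : nat) (x : nvec p) : 'cV[R]_p :=
  \col_i (x i ord0)%:R.
Definition zvecR (R : realType) (p : nat) (x : zvec p) : 'cV[R]_p :=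
  \col_i (x i ord0)%:~R.

Arguments nvecR R {p} x.
Arguments zvecR R {p} x.

Section random_vectors.
Context (d : measure_display) (T : measurableType d) (R : realType).
Variable P : probability T R.

Definition square_integrable (p : nat) (Y : T -> 'cV[R]_p) : Prop :=
  forall i, (fun w => Y w i ord0) \in Lfun P 2%:E.

(* [fine] is harmless on square-integrable vectors, the only ones to which
   [mean_vec] and [cov_mx] are meant to be applied. *)
Definition mean_vec (p : nat) (Y : T -> 'cV[R]_p) : 'cV[R]_p :=
  \col_i fine 'E_P[fun w => Y w i ord0].

Definition cov_mx (p : nat) (Y : T -> 'cV[R]_p) : 'M[R]_p :=
  \matrix_(i, j) fine
    (covariance P (fun w => Y w i ord0) (fun w => Y w j ord0)).

Definition sigma_rv (d' : measure_display) (U : measurableType d')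
    (Y : T -> U) : set_system T :=
  preimage_set_system setT Y measurable.

Definition mutually_independent (I : eqType) (F : I -> set_system T) : Prop :=
  forall (s : seq I) (E : I -> set T), uniq s ->
    (forall i, i \in s -> F i (E i)) ->
    P (\bigcap_(i in [set` s]) E i) = (\prod_(i <- s) P (E i))%E.

(* Regular conditional distribution of [Y] given <<s G >>. *)
Definition is_cond_distribution (G : set_system T) (d' : measure_display)
    (U : measurableType d') (Y : T -> U) (kappa : T -> probability U R) : Prop :=
  (forall A : set U, measurable A ->
     measurable_fun [set: g_sigma_algebraType G] (fun w => kappa w A)) /\
  (forall (B : set T) (A : set U), <<s G >> B -> measurable A ->
     (\int[P]_(w in B) kappa w A)%E = P (B `&` Y @^-1` A)).

End random_vectors.

Definition odot (R : realType) (p : nat) (z : 'cV[R]_p) (A : 'I_p -> 'M[R]_p)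
  : 'M[R]_p := \sum_(i < p) z i ord0 *: A i.

Section mbpm_def.
Context (d : measure_display) (T : measurableType d) (R : realType).
Variable P : probability T R.

Definition mbpm_index (p : nat) : Type :=
  (unit + nat * nat * 'I_p + nat * nvec p)%type.
HB.instance Definition _ (p : nat) := Countable.copy (mbpm_index p)
  (unit + nat * nat * 'I_p + nat * nvec p)%type.

Definition mbpm_sigma (p : nat) (Z0 : T -> nvec p)
    (X : nat -> nat -> 'I_p -> T -> nvec p) (M : nat -> nvec p -> T -> zvec p)
    (x : mbpm_index p) : set_system T :=
  match x with
  | inl (inl _) => sigma_rv Z0
  | inl (inr (k, j, i)) => sigma_rv (X k j i)
  | inr (k, z) => sigma_rv (M k z)
  end.

(* [prob_none], [prob_imm] and [prob_em] are the functions p_i, q_i and r_i.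
   The individuals of a type are numbered from 0: [offspring k j i] is the
   vector usually written X_{k,j+1,i}. *)
Record mbpm (p : nat) := MBPM {
  initial : {RV P >-> nvec p};
  offspring : nat -> nat -> 'I_p -> {RV P >-> nvec p};
  emigration : nat -> nvec p -> {RV P >-> nvec p};
  immigration : nat -> nvec p -> {RV P >-> nvec p};
  migration : nat -> nvec p -> {RV P >-> zvec p};
  prob_none : nvec p -> 'I_p -> R;
  prob_imm : nvec p -> 'I_p -> R;
  prob_em : nvec p -> 'I_p -> R;

  offspring_id : forall k j i,
    distribution P (offspring k j i) = distribution P (offspring 0 0 i);

  emigration_id : forall k z,
    distribution P (emigration k z) = distribution P (emigration 0 z);
  emigration0 : forall k (z : nvec p) i w,
    z i ord0 = 0%N -> emigration k z w i ord0 = 0%N;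
  emigration_gt0 : forall k (z : nvec p) i w, (0 < z i ord0)%N ->
    (1 <= emigration k z w i ord0 <= z i ord0)%N;

  immigration_id : forall k z,
    distribution P (immigration k z) = distribution P (immigration 0 z);
  immigration_gt0 : forall k (z : nvec p) i w,
    (0 < immigration k z w i ord0)%N;

  prob_none_itv : forall z i, 0 <= prob_none z i <= 1;
  prob_imm_itv : forall z i, 0 <= prob_imm z i <= 1;
  prob_em_itv : forall z i, 0 <= prob_em z i <= 1;
  prob_sum1 : forall z i, prob_none z i + prob_imm z i + prob_em z i = 1;
  prob_em0 : forall (z : nvec p) i, z i ord0 = 0%N -> prob_em z i = 0;

  migration_id : forall k z,
    distribution P (migration k z) = distribution P (migration 0 z);
  migration_ge : forall k (z : nvec p) i w,
    - (z i ord0)%:Z <= migration k z w i ord0;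
  migration_mixture : forall k (z : nvec p) i (A : set int),
    P [set w | A (migration k z w i ord0)] =
    ((prob_none z i * \1_A (0 : int))%:E +
     (prob_imm z i)%:E * P [set w | A (immigration k z w i ord0)%:Z] +
     (prob_em z i)%:E * P [set w | A (- (emigration k z w i ord0)%:Z)%R])%E;

  mbpm_indep : mutually_independent P (mbpm_sigma initial offspring migration)
}.

Section mbpm_theory.
Variables (p : nat) (W : mbpm p).

(* [absz] is the identity here, by [migration_ge]. *)
Fixpoint mbpm_process (k : nat) (w : T) : nvec p :=
  if k is k'.+1 then
    let z := mbpm_process k' w in
    \sum_(i < p)
      \sum_(j < `|((z i ord0)%:Z + migration W k' z w i ord0)%R|%N)
        offspring W k' j i w
  else initial W w.

(* Generators only: <<s mbpm_history k >> is the sigma-algebra of Z_0, ..., Z_k *)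
Definition mbpm_history (k : nat) : set_system T :=
  \bigcup_(l in [set l | (l <= k)%N]) sigma_rv (mbpm_process l).

Definition finite_moments : Prop :=
  [/\ forall i, square_integrable P (nvecR R \o offspring W 0 0 i),
      forall z, square_integrable P (zvecR R \o migration W 0 z),
      forall z i, (fun w => (immigration W 0 z w i ord0)%:R : R) \in Lfun P 1 &
      forall z i, (fun w => (emigration W 0 z w i ord0)%:R : R) \in Lfun P 1].

(* The matrix whose i-th column is the mean offspring vector of type i. *)
Definition offspring_mean : 'M[R]_p :=
  \matrix_(l, i) mean_vec P (nvecR R \o offspring W 0 0 i) l ord0.

Definition offspring_cov (i : 'I_p) : 'M[R]_p :=
  cov_mx P (nvecR R \o offspring W 0 0 i).

(* By [migration_mixture], the i-th entry is a_i(z) q_i(z) - b_i(z) r_i(z), where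
   a_i(z) and b_i(z) are the means of the i-th entries of [immigration W 0 z]
   and [emigration W 0 z]. *)
Definition migration_mean (z : nvec p) : 'cV[R]_p :=
  mean_vec P (zvecR R \o migration W 0 z).

Definition migration_cov (z : nvec p) : 'M[R]_p :=
  cov_mx P (zvecR R \o migration W 0 z).

End mbpm_theory.
End mbpm_def.

(* Main.v *)
Require Import Defs.
From HB Require Import structures.
From mathcomp Require Import all_boot all_order all_algebra.
From mathcomp Require Import all_classical all_reals all_analysis.
From mathcomp Require Import measurable_realfun.
Import Order.TTheory GRing.Theory Num.Theory.
Import numFieldNormedType.Exports.
Local Open Scope classical_set_scope.
Local Open Scope ring_scope.

(* Given Z_k = z, the next generation is a random sum over independent
   individuals, driven by the sources (migration and offspring) of time k only.
   These are independent of Z_0, ..., Z_k, so the law of that sum is a version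
   of the conditional law.  As trajectories (Z_0, ..., Z_k) take countably many
   values, any other version agrees with it on each trajectory of positive
   probability, hence almost surely.
   The first two moments of the random sum come from decomposing along the
   values n of the population N after migration.  All the integrands are
   nonnegative, and on {N = n} a pair of individuals contributes a product of
   means, plus a covariance when the two are the same, so
   E[Y_a Y_b] = E[(m N)_a (m N)_b] + (E[N] (.) Sigma)_ab. *)

Set Implicit Arguments.
Unset Strict Implicit.

(** * Functions with measurable fibers *)

Definition measurable_fibers {d} {T : measurableType d} {V : Type}
  (f : T -> V) := forall v, measurable (f @^-1` [set v]).

Section fibers.
Context {d} {T : measurableType d}.

(** A countable codomain makes every preimage a countable union of fibers. *)
Lemma measurable_fibers_preimage (V : countType) (f : T -> V) (A : set V) :
  measurable_fibers f -> measurable (f @^-1` A).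
Proof.
move=> mf; have -> : f @^-1` A =
    \bigcup_v (if v \in A then f @^-1` [set v] else set0).
  apply/seteqP; split=> [w Afw|w [v _]].
    by exists (f w) => //; rewrite mem_set.
  by case: ifPn => // /set_mem Av /= ->.
apply: countable_bigcupT_measurable => [|v]; first exact: countableP.
by case: ifPn.
Qed.

Lemma measurable_fibers_cst {V : Type} (v : V) :
  measurable_fibers (fun _ : T => v).
Proof.
move=> u; have [->|vu] := pselect (v = u).
  by rewrite (_ : _ @^-1` _ = setT)//; apply/seteqP; split.
by rewrite (_ : _ @^-1` _ = set0)//; apply/seteqP; split.
Qed.

(** On each of the countably many fibers of [f] the index of [g] is fixed, so a random index is
    harmless. This covers sums with a random number of terms. *)
Lemma measurable_fibers_bind (V : countType) {U : Type} (f : T -> V)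
    (g : V -> T -> U) :
  measurable_fibers f -> (forall v, measurable_fibers (g v)) ->
  measurable_fibers (fun w => g (f w) w).
Proof.
move=> mf mg u.
have -> : (fun w => g (f w) w) @^-1` [set u] =
    \bigcup_v (f @^-1` [set v] `&` g v @^-1` [set u]).
  apply/seteqP; split=> [w /= gu|w [v _] [/= -> //]].
  by exists (f w).
apply: countable_bigcupT_measurable => [|v]; first exact: countableP.
by apply: measurableI => //; apply: mg.
Qed.

Lemma measurable_fibers_comp (V : countType) {U : Type} (f : T -> V)
    (g : V -> U) :
  measurable_fibers f -> measurable_fibers (g \o f).
Proof.
by move=> mf; apply: (@measurable_fibers_bind _ _ f (fun v _ => g v)) => // v;
  apply: measurable_fibers_cst.
Qed.

Lemma measurable_fibersD p (f g : T -> nvec p) :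
  measurable_fibers f -> measurable_fibers g ->
  measurable_fibers (fun w => f w + g w).
Proof.
move=> mf mg.
apply: (@measurable_fibers_bind _ _ f (fun u w => u + g w)) => // u.
exact: measurable_fibers_comp.
Qed.

Lemma measurable_fibers_sum p (I : Type) (r : seq I) (f : I -> T -> nvec p) :
  (forall i, measurable_fibers (f i)) ->
  measurable_fibers (fun w => \sum_(i <- r) f i w).
Proof.
move=> mf; elim: r => [|i r IH].
  by under eq_fun do rewrite big_nil; apply: measurable_fibers_cst.
by under eq_fun do rewrite big_cons; apply: measurable_fibersD.
Qed.

Lemma measurable_fibers_fun {d'} (U : measurableType d') (V : countType)
    (f : T -> V) (g : V -> U) :
  measurable_fibers f -> measurable_fun setT (g \o f).
Proof.
move=> mf _ A _; rewrite setTI comp_preimage.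
exact: measurable_fibers_preimage.
Qed.

End fibers.

(** * Comparison of integrals fiber by fiber *)

Section integral_fibers.
Context {d} {T : measurableType d} {R : realType}.
Variable P : {measure set T -> \bar R}.
Local Open Scope ereal_scope.

(** Countable additivity over the fibers of [f]. The domains [B1] and [B2] may differ, which allows
    an event to be traded for a factor in the integrand. *)
Lemma eq_integral_fibers (V : countType) (f : T -> V) (B1 B2 : set T)
    (g1 g2 : T -> \bar R) :
  measurable_fibers f -> measurable B1 -> measurable B2 ->
  measurable_fun setT g1 -> measurable_fun setT g2 ->
  (forall w, 0 <= g1 w) -> (forall w, 0 <= g2 w) ->
  (forall v, \int[P]_(w in B1 `&` f @^-1` [set v]) g1 w =
             \int[P]_(w in B2 `&` f @^-1` [set v]) g2 w) ->
  \int[P]_(w in B1) g1 w = \int[P]_(w in B2) g2 w.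
Proof.
move=> mf mB1 mB2 mg1 mg2 g10 g20 eqv.
(* The fibers are indexed by their [pickle] codes, since the series that splits the integral runs
   over [nat]. *)
pose F (B : set T) n := B `&` f @^-1` [set v | pickle v = n].
have Bcup B : B = \bigcup_n F B n.
  apply/seteqP; split=> [w Bw|w [n _] []//].
  by exists (pickle (f w)).
have mF B n : measurable B -> measurable (F B n).
  by move=> mB; apply: measurableI => //; apply: measurable_fibers_preimage.
have tF B : trivIset setT (F B).
  by move=> m n _ _ [w [[_ /= <-] [_ /= <-]]].
have fiberE B g : measurable B -> measurable_fun setT g -> (forall w, 0 <= g w) ->
    \int[P]_(w in B) g w = \sum_(n <oo) \int[P]_(w in F B n) g w.
  move=> mB mg g0; rewrite {1}[B]Bcup ge0_integral_bigcup//.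
    by move=> n; apply: mF.
  exact: measurable_funTS.
rewrite !fiberE//.
apply: eq_eseriesr => n _; rewrite /F.
(* Only codes of the form [pickle v] carry a nonempty piece. [unpickle] may fail at n, or return a v
   whose own code is not n; then both pieces are empty. *)
case E : (unpickle n : option V) => [v|]; last first.
  rewrite (_ : [set v : V | _] = set0) ?preimage_set0 ?setI0 ?integral_set0//.
  by apply/seteqP; split=> // v /= vn; move: E; rewrite -vn pickleK.
have [vn|vn] := eqVneq (pickle v) n.
  rewrite (_ : [set v : V | _] = [set v]) ?eqv//.
  apply/seteqP; split=> [u /= un|u /= ->//].
  by move: E; rewrite -un pickleK => -[].
rewrite (_ : [set v : V | _] = set0) ?preimage_set0 ?setI0 ?integral_set0//.
apply/seteqP; split=> // u /= un; move: E vn.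
by rewrite -un pickleK => -[->]; rewrite eqxx.
Qed.

End integral_fibers.

(** * Integrals of products of independent factors *)

Section independent_products.
Context {d} {T : measurableType d} {R : realType}.
Variable P : probability T R.
Local Open Scope ereal_scope.

(** On a fiber of [X] both integrands are constant, so only probabilities of fibers enter. *)
Lemma integral_indep (V : countType) (X : T -> V) (f : V -> R) (B : set T) :
  measurable_fibers X -> measurable B -> (forall v, 0 <= f v)%R ->
  (forall v, P (B `&` X @^-1` [set v]) = P B * P (X @^-1` [set v])) ->
  \int[P]_(w in B) (f (X w))%:E = P B * \int[P]_w (f (X w))%:E.
Proof.
move=> mX mB f0 indep.
have mfX : measurable_fun setT (fun w => (f (X w))%:E).
  exact: (@measurable_fibers_fun _ _ _ _ _ X (EFin \o f)).
rewrite -ge0_integralZl//; last by move=> w _; rewrite lee_fin.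
apply: (@eq_integral_fibers _ _ _ _ _ X) => //.
- exact: measurable_funeM.
- by move=> w; rewrite lee_fin.
- by move=> w; rewrite mule_ge0// lee_fin.
move=> v; rewrite setTI.
transitivity (\int[P]_(w in B `&` X @^-1` [set v]) (f v)%:E).
  by apply: eq_integral => w /set_mem[_ /= ->].
transitivity (\int[P]_(w in X @^-1` [set v]) (P B * (f v)%:E)); last first.
  by apply: eq_integral => w /set_mem /= ->.
rewrite !integral_cst//; last exact: measurableI.
by rewrite [X in _ * X = _]indep [P B * (f v)%:E]muleC muleA.
Qed.

(** The factors are peeled off one at a time: on {X = v} the first one is constant, and
    [integral_indep] applies to [Y] with the event [B] cut by {X = v}. *)
Lemma integral_indep2 (V U : countType) (X : T -> V) (Y : T -> U)
    (f : V -> R) (g : U -> R) (B : set T) :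
  measurable_fibers X -> measurable_fibers Y -> measurable B ->
  (forall v, 0 <= f v)%R -> (forall v, 0 <= g v)%R ->
  (forall v, P (B `&` X @^-1` [set v]) = P B * P (X @^-1` [set v])) ->
  (forall v u, P (B `&` X @^-1` [set v] `&` Y @^-1` [set u]) =
    P (B `&` X @^-1` [set v]) * P (Y @^-1` [set u])) ->
  \int[P]_(w in B) (f (X w) * g (Y w))%:E =
  P B * (\int[P]_w (f (X w))%:E * \int[P]_w (g (Y w))%:E).
Proof.
move=> mX mY mB f0 g0 indX indY.
have mfX : measurable_fun setT (fun w => (f (X w))%:E).
  exact: (@measurable_fibers_fun _ _ _ _ _ X (EFin \o f)).
have mgY : measurable_fun setT (fun w => (g (Y w))%:E).
  exact: (@measurable_fibers_fun _ _ _ _ _ Y (EFin \o g)).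
have gY0 : 0 <= \int[P]_w (g (Y w))%:E.
  by apply: integral_ge0 => w _; rewrite lee_fin.
rewrite [X in _ * X]muleC muleA -ge0_integralZl//; last 2 first.
- by move=> w _; rewrite lee_fin.
- exact: mule_ge0.
apply: (@eq_integral_fibers _ _ _ _ _ X) => //.
- by under eq_fun do rewrite EFinM; apply: emeasurable_funM.
- exact: measurable_funeM.
- by move=> w; rewrite lee_fin mulr_ge0.
- by move=> w; rewrite mule_ge0 ?mule_ge0// lee_fin.
move=> v; rewrite setTI.
have mBX : measurable (B `&` X @^-1` [set v]) by exact: measurableI.
transitivity (\int[P]_(w in B `&` X @^-1` [set v]) ((f v)%:E * (g (Y w))%:E)).
  by apply: eq_integral => w /set_mem[_ /= ->].
transitivity (\int[P]_(w in X @^-1` [set v])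
    (P B * \int[P]_w (g (Y w))%:E * (f v)%:E)); last first.
  by apply: eq_integral => w /set_mem /= ->.
rewrite ge0_integralZl//; first last.
- by rewrite lee_fin.
- by move=> w _; rewrite lee_fin.
- exact: measurable_funTS.
rewrite (integral_indep mY mBX g0 (indY v)) (integral_cst _ (mX v)).
rewrite [X in _ * (X * _) = _]indX.
by rewrite [LHS]muleC -[LHS]muleA [LHS]muleAC [in LHS]muleA.
Qed.

End independent_products.

(** * Independence of sigma-algebras generated by disjoint blocks *)

Section independent_blocks.
Context {d} {T : measurableType d} {R : realType}.
Variable P : probability T R.
Context {I : choiceType}.
Variable F : I -> set_system T.
Hypothesis Fm : forall i, F i `<=` measurable.
Hypothesis FT : forall i, F i setT.
Hypothesis FI : forall i, setI_closed (F i).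
Hypothesis indF : mutually_independent P F.

Definition block (J : pred I) : set_system T :=
  [set A | exists2 i, J i & F i A].

(** A pi-system containing [block J], which itself need not be closed under intersection. *)
Let cylinders (J : pred I) : set_system T :=
  [set A | exists s (E : I -> set T), [/\ uniq s, all J s,
     (forall i, i \in s -> F i (E i)) & A = \bigcap_(i in [set` s]) E i]].

Let block_cylinders J : block J `<=` cylinders J.
Proof.
move=> A [i Ji FA]; exists [:: i], (fun=> A); split => //=.
- by rewrite Ji.
- by move=> j; rewrite inE => /eqP ->.
- by rewrite set_cons1 bigcap_set1.
Qed.

Let cylinders_measurable J : cylinders J `<=` measurable.
Proof.
move=> A [s [E [_ _ FE ->]]].
rewrite bigcap_seq; elim: s FE => [|i s IH] FE; first by rewrite big_nil.
rewrite big_cons; apply: measurableI.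
  by apply/Fm/FE; rewrite mem_head.
by apply: IH => j js; apply: FE; rewrite inE js orbT.
Qed.

Let cylinders_setI J : setI_closed (cylinders J).
Proof.
move=> A B [s [E [us Js FE ->]]] [t [G [ut Jt FG ->]]].
(* The index lists are merged; an index missing from one list gets [setT] there, and [FI] handles an
   index present in both. *)
exists (undup (s ++ t)), (fun i => (if i \in s then E i else setT) `&`
  (if i \in t then G i else setT)); split.
- exact: undup_uniq.
- apply/allP => i; rewrite mem_undup mem_cat => /orP[].
    by move/(allP Js).
  by move/(allP Jt).
- move=> i _; apply: FI; case: ifPn => //; [exact: FE|exact: FG].
- apply/seteqP; split=> [w [Ew Gw] i /= _|w EGw].
    by split; case: ifPn => // ?; [apply: Ew|apply: Gw].
  split=> i /= si.
  + have := EGw i; rewrite /= mem_undup mem_cat si /= => /(_ isT) [].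
    by [].
  + by have := EGw i; rewrite /= mem_undup mem_cat si orbT => /(_ isT) [].
Qed.

Let cylinders_indep (J1 J2 : pred I) (A B : set T) :
  (forall i, J1 i -> ~~ J2 i) ->
  cylinders J1 A -> cylinders J2 B -> P (A `&` B) = (P A * P B)%E.
Proof.
move=> J12 [s [E [us Js FE ->]]] [t [G [ut Jt FG ->]]].
(* One family for both lists: the blocks being disjoint, [J1] tells which event belongs to an
   index. *)
pose H i := if J1 i then E i else G i.
have sE i : i \in s -> H i = E i by move=> /(allP Js); rewrite /H => ->.
have tG i : i \in t -> H i = G i.
  move=> /(allP Jt) J2i; rewrite /H; case: ifPn => // J1i.
  by have := J12 i J1i; rewrite J2i.
have -> : \bigcap_(i in [set` s]) E i `&` \bigcap_(i in [set` t]) G i =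
    \bigcap_(i in [set` s ++ t]) H i.
  apply/seteqP; split=> [w [Ew Gw] i /=|w Hw].
    by rewrite mem_cat => /orP[] it;
      [rewrite sE//; apply: Ew|rewrite tG//; apply: Gw].
  split=> i /= it; [rewrite -sE//|rewrite -tG//]; apply: Hw => /=.
    by rewrite mem_cat it.
  by rewrite mem_cat it orbT.
rewrite indF; first last.
- by move=> i; rewrite mem_cat => /orP[] it;
    [rewrite sE//; apply: FE|rewrite tG//; apply: FG].
- rewrite cat_uniq us ut andbT /=; apply/hasPn => i /(allP Jt) J2i.
  apply/negP => /(allP Js) J1i.
  by have := J12 i J1i; rewrite J2i.
rewrite big_cat /= !indF//.
by congr (_ * _)%E; apply: eq_big_seq => i it; [rewrite sE|rewrite tG].
Qed.

(** Both sides are finite measures in A that agree on the pi-system [G], hence on the sigma-algebra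
    it generates. *)
Let indep_sigma G (B : set T) : G `<=` measurable -> G setT ->
  setI_closed G -> measurable B ->
  (forall A, G A -> P (A `&` B) = (P A * P B)%E) ->
  forall A, <<s G >> A -> P (A `&` B) = (P A * P B)%E.
Proof.
move=> Gm GT GI mB indGB A GA.
have B0 : (0 <= fine (P B))%R by rewrite fine_ge0.
transitivity (mscale (NngNum B0) P A); last first.
  by rewrite /mscale/= fineK ?fin_num_measure// muleC.
apply: (@g_sigma_algebra_measure_unique _ R T G Gm (fun=> setT) _ _
  (mrestr P mB) (mscale (NngNum B0) P) GI) => //.
- by rewrite bigcup_const//; exists 0%N.
- move=> C GC; transitivity (P C * P B)%E; first exact: indGB.
  rewrite muleC -[X in (X * _)%E = _]fineK ?fin_num_measure//.
- have PBoo : (P (setT `&` B) < +oo)%E.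
    by rewrite (le_lt_trans (probability_le1 _ _)) ?ltry// setTI.
  by move=> _; exact: PBoo.
Qed.

Lemma block_measurable J : <<s block J >> `<=` measurable.
Proof.
apply: smallest_sub; first exact: sigma_algebra_measurable.
by move=> A [i _] /Fm.
Qed.

(** The pi-system argument runs twice, once per block, with the other event held fixed. *)
Lemma indep_blocks (J1 J2 : pred I) (A B : set T) : (forall i, J1 i -> ~~ J2 i) ->
  <<s block J1 >> A -> <<s block J2 >> B -> P (A `&` B) = (P A * P B)%E.
Proof.
move=> J12 bA bB.
have cT J : cylinders J setT.
  exists [::], (fun=> setT); split => //.
  by rewrite bigcap_seq big_nil.
have cb J : <<s block J >> `<=` <<s cylinders J >>.
  apply: smallest_sub; first exact: smallest_sigma_algebra.
  by move=> C /block_cylinders; apply: sub_sigma_algebra.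
apply: (indep_sigma (@cylinders_measurable J1)) => //.
- exact: block_measurable bB.
- move=> C cC; rewrite setIC [RHS]muleC.
  apply: (indep_sigma (@cylinders_measurable J2)) => //.
  + exact: cylinders_measurable cC.
  + by move=> D cD; rewrite setIC [RHS]muleC; apply: cylinders_indep cC cD.
  + exact: cb.
- exact: cb.
Qed.

End independent_blocks.

(** * The next generation and the sources that drive it *)

Section next_generation.
Context {d : measure_display} {T : measurableType d} {R : realType}
  {P : probability T R} {p : nat}.
Variable W : mbpm P p.

Definition population (z : nvec p) (m : zvec p) : nvec p :=
  \col_i `|((z i ord0)%:Z + m i ord0)%R|%N.

Definition offspring_total (k : nat) (n : nvec p) (w : T) : nvec p :=
  \sum_(i < p) \sum_(j < n i ord0) offspring W k j i w.

Definition next_generation (k : nat) (z : nvec p) (w : T) : nvec p :=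
  offspring_total k (population z (migration W k z w)) w.

Lemma mbpm_processS k w :
  mbpm_process W k.+1 w = next_generation k (mbpm_process W k w) w.
Proof. by apply: eq_bigr => i _; rewrite mxE. Qed.

Definition source_sigma :=
  mbpm_sigma (initial W) (offspring W) (migration W).

(** The time of the first generation a source can affect: migration and offspring of step k enter
    Z_(k+1), hence the shift, which leaves time 0 to Z_0 alone. *)
Definition index_time (x : mbpm_index p) : nat :=
  match x with
  | inl (inl _) => 0
  | inl (inr (k, _, _)) => k.+1
  | inr (k, _) => k.+1
  end.

Lemma source_sigma_measurable x : source_sigma x `<=` measurable.
Proof.
case: x => [[?|[[k j] i]]|[k z]] A /= [B _ <-];
  rewrite setTI -[X in measurable X]setTI.
- exact: (measurable_funP (initial W)).
- exact: (measurable_funP (offspring W k j i)).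
- exact: (measurable_funP (migration W k z)).
Qed.

Lemma source_sigma_setT x : source_sigma x setT.
Proof.
by case: x => [[?|[[k j] i]]|[k z]] /=; exists setT => //;
  rewrite preimage_setT setTI.
Qed.

Lemma source_sigma_setI x : setI_closed (source_sigma x).
Proof.
by case: x => [[?|[[k j] i]]|[k z]] /= _ _ [A _ <-] [B _ <-];
  exists (A `&` B) => //; rewrite !setTI preimage_setI.
Qed.

Definition source_space (J : pred (mbpm_index p)) :=
  g_sigma_algebraType (block source_sigma J).

(** Measurability with respect to the sources in [J], phrased through fibers so that the closure
    lemmas for [measurable_fibers] apply with [source_space J] as the domain. *)
Definition driven_by (J : pred (mbpm_index p)) {V : Type} (f : T -> V) :=
  measurable_fibers (f : source_space J -> V).

Lemma next_generation_driven k z :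
  driven_by (fun x => index_time x == k.+1) (next_generation k z).
Proof.
pose S := source_space (fun x => index_time x == k.+1).
(* Binding over the population after migration leaves sums with a fixed number of terms. *)
apply: (@measurable_fibers_bind _ S _ _
    (fun w => population z (migration W k z w)) (offspring_total k)) => [|n].
  apply: (@measurable_fibers_comp _ S _ _ (migration W k z)
    (population z)) => m.
  apply: sub_sigma_algebra; exists (inr (k, z)) => //=.
  by exists [set m] => //; rewrite setTI.
apply: measurable_fibers_sum => i; apply: measurable_fibers_sum => j x.
apply: sub_sigma_algebra; exists (inl (inr (k, val j, i))) => //=.
by exists [set x] => //; rewrite setTI.
Qed.

Lemma driven_by_sub (J1 J2 : pred (mbpm_index p)) {V : Type} (f : T -> V) :
  (forall x, J1 x -> J2 x) -> driven_by J1 f -> driven_by J2 f.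
Proof.
move=> J12 f1 v; apply: sub_sigma_algebra2 (f1 v) => A [x /J12 J2x Ax].
by exists x.
Qed.

Lemma mbpm_process_driven k l : (l <= k)%N ->
  driven_by (fun x => index_time x <= k)%N (mbpm_process W l).
Proof.
elim: l => [_|l IH lk].
  move=> x; apply: sub_sigma_algebra; exists (inl (inl tt)) => //=.
  by exists [set x] => //; rewrite setTI.
rewrite (_ : mbpm_process W l.+1 =
  fun w => next_generation l (mbpm_process W l w) w); last first.
  by apply/funext => w; exact: mbpm_processS.
apply: (@measurable_fibers_bind _ (source_space (fun x => index_time x <= k)%N) _ _
  (mbpm_process W l) (next_generation l)) => [|z]; first exact: IH (ltnW lk).
have timeS x : index_time x == l.+1 -> (index_time x <= k)%N by move=> /eqP ->.
exact: (driven_by_sub timeS (@next_generation_driven l z)).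
Qed.

Lemma driven_by_measurable J {V : Type} (f : T -> V) :
  driven_by J f -> measurable_fibers f.
Proof.
by move=> mf v; apply: (block_measurable source_sigma_measurable (mf v)).
Qed.

Lemma next_generation_measurable k z : measurable_fibers (next_generation k z).
Proof. exact: driven_by_measurable (@next_generation_driven k z). Qed.

Lemma mbpm_process_measurable k : measurable_fibers (mbpm_process W k).
Proof. exact: driven_by_measurable (mbpm_process_driven (leqnn k)). Qed.

Lemma mbpm_history_driven k : <<s mbpm_history W k >> `<=`
  <<s block source_sigma (fun x => index_time x <= k)%N >>.
Proof.
apply: smallest_sub; first exact: smallest_sigma_algebra.
move=> _ [l /= lk [A _ <-]]; rewrite setTI.
exact: (@measurable_fibers_preimage _ (source_space _) _ _ A (mbpm_process_driven lk)).
Qed.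

Lemma mbpm_history_measurable k : <<s mbpm_history W k >> `<=` measurable.
Proof.
by move=> A /mbpm_history_driven; apply: (block_measurable source_sigma_measurable).
Qed.

(** The history depends on sources of time at most k, and the generation born from a fixed state on
    those of time k+1: two disjoint blocks. *)
Lemma next_generation_indep k z (B : set T) (A : set (nvec p)) :
  <<s mbpm_history W k >> B ->
  P (B `&` next_generation k z @^-1` A) =
  (P B * P (next_generation k z @^-1` A))%E.
Proof.
move=> hB; apply: (indep_blocks source_sigma_measurable source_sigma_setT source_sigma_setI
  (@mbpm_indep _ _ _ _ _ W) (J1 := fun x => (index_time x <= k)%N)
  (J2 := fun x => index_time x == k.+1)).
- by move=> x xk; rewrite neq_ltn ltnS xk.
- exact: mbpm_history_driven hB.
- exact: (@measurable_fibers_preimage _ (source_space _) _ _ A (@next_generation_driven k z)).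
Qed.

(** * A version of the conditional law *)

Lemma mbpm_process_history k l : (l <= k)%N ->
  measurable_fibers
    (mbpm_process W l : g_sigma_algebraType (mbpm_history W k) -> nvec p).
Proof.
move=> lk z; apply: sub_sigma_algebra; exists l => //.
by exists [set z] => //; rewrite setTI.
Qed.

Lemma next_generation_measurable_fun k z :
  measurable_fun setT (next_generation k z).
Proof.
exact: (@measurable_fibers_fun _ _ _ (nvec p) (nvec p) _ id (@next_generation_measurable k z)).
Qed.

(** Lets [distribution P (next_generation k z)] be formed as a probability. *)
HB.instance Definition _ k z := isMeasurableFun.Build _ _ _ _
  (next_generation k z) (next_generation_measurable_fun k z).

Lemma setI_mbpm_processS k z (B : set T) (A : set (nvec p)) :
  B `&` mbpm_process W k @^-1` [set z] `&` mbpm_process W k.+1 @^-1` A =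
  B `&` mbpm_process W k @^-1` [set z] `&` next_generation k z @^-1` A.
Proof.
apply/seteqP; split=> w [[Bw zw]]; rewrite /preimage/= => Aw; split => //=.
  by rewrite -zw -mbpm_processS.
by move: Aw; rewrite -zw -mbpm_processS.
Qed.

(** On {Z_k = z} the kernel is constant and Z_(k+1) coincides with [next_generation k z], which is
    independent of the history; so both sides are the same product on each such piece of [B]. *)
Lemma mbpm_cond_distribution k :
  is_cond_distribution P (mbpm_history W k) (mbpm_process W k.+1)
    (fun w => distribution P (next_generation k (mbpm_process W k w))).
Proof.
split=> [A mA|B A hB mA].
  exact: (@measurable_fibers_fun _ _ _ _ _ _
    (fun z => P (next_generation k z @^-1` A))
    (mbpm_process_history (leqnn k))).
have mB := mbpm_history_measurable hB.
have mZA : measurable (mbpm_process W k.+1 @^-1` A).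
  exact: (measurable_fibers_preimage A (@mbpm_process_measurable k.+1)).
rewrite setIC.
transitivity (\int[P]_(w in B) (\1_(mbpm_process W k.+1 @^-1` A) w)%:E)%E;
  last exact: (integral_indic P mB mZA).
apply: (@eq_integral_fibers _ _ _ _ _ (mbpm_process W k)) => //.
- exact: mbpm_process_measurable.
- exact: (@measurable_fibers_fun _ _ _ _ _ _
    (fun z => P (next_generation k z @^-1` A))
    (@mbpm_process_measurable k)).
- by apply/measurable_EFinP; exact: measurable_indic.
move=> z.
have hBz : <<s mbpm_history W k >> (B `&` mbpm_process W k @^-1` [set z]).
  apply: (@measurableI _ (g_sigma_algebraType (mbpm_history W k))) => //.
  exact: (mbpm_process_history (leqnn k)).
have mBz := mbpm_history_measurable hBz.
transitivity (\int[P]_(w in B `&` mbpm_process W k @^-1` [set z])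
    P (next_generation k z @^-1` A))%E.
  by apply: eq_integral => w /set_mem[_ /= ->].
rewrite (integral_indic P mBz mZA) (integral_cst P mBz) muleC.
rewrite [RHS](_ : _ = P (B `&` mbpm_process W k @^-1` [set z] `&`
    mbpm_process W k.+1 @^-1` A)); last by rewrite setIC.
by rewrite setI_mbpm_processS; apply/esym/next_generation_indep.
Qed.

(** * Trajectories and uniqueness of the conditional law *)

Definition trajectory k w : seq (nvec p) :=
  [seq mbpm_process W l w | l <- iota 0 k.+1].

Lemma trajectory_history k : measurable_fibers
  (trajectory k : g_sigma_algebraType (mbpm_history W k) -> seq (nvec p)).
Proof.
have : {subset iota 0 k.+1 <= [pred l | (l <= k)%N]}.
  by move=> l; rewrite mem_iota.
rewrite /trajectory; elim: (iota 0 k.+1) => [_|l r IH rk].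
  exact: measurable_fibers_cst.
apply: (@measurable_fibers_bind _ (g_sigma_algebraType (mbpm_history W k)) _ _
  (mbpm_process W l) (fun z w => z :: [seq mbpm_process W l w | l <- r])).
  by apply: mbpm_process_history; apply: rk; rewrite mem_head.
move=> z.
apply: (@measurable_fibers_comp _ (g_sigma_algebraType (mbpm_history W k)) _ _
  (fun w => [seq mbpm_process W l w | l <- r]) (cons z)).
by apply: IH => j jr; apply: rk; rewrite inE jr orbT.
Qed.

Lemma eq_trajectory k w w' l : trajectory k w = trajectory k w' -> (l <= k)%N ->
  mbpm_process W l w = mbpm_process W l w'.
Proof.
move=> /eq_in_map eqt lk; apply: eqt.
by rewrite mem_iota.
Qed.

(** The sets that do not separate w from w' form a sigma-algebra, and it contains the generators
    because the trajectory determines Z_0, ..., Z_k. *)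
Lemma history_saturated k (B : set T) w w' : <<s mbpm_history W k >> B ->
  trajectory k w = trajectory k w' -> B w -> B w'.
Proof.
move=> hB eqt; suff : B w <-> B w' by case.
suff H : <<s mbpm_history W k >> `<=` [set C | C w <-> C w'] by exact: H hB.
apply: smallest_sub.
  split=> //= [C CE|F].
    by split=> -[_ nC]; split=> // ?; apply/nC/CE.
  by move=> FE; split=> -[n _ Fn]; exists n => //; apply/(FE n).
move=> _ [l lk [A _ <-]]; rewrite setTI /preimage /=.
by rewrite (eq_trajectory eqt lk).
Qed.

(** One exceptional set must serve all [A] at once: it is the union of the null atoms, countable in
    number. On any other atom the integral identity over that atom forces the value of [kappa]. *)
Lemma cond_distribution_unique k (kappa : T -> probability (nvec p) R) :
  is_cond_distribution P (mbpm_history W k) (mbpm_process W k.+1) kappa ->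
  {ae P, forall w, forall A, kappa w A =
     P (next_generation k (mbpm_process W k w) @^-1` A)}.
Proof.
move=> [mkappa intkappa].
pose atom t := trajectory k @^-1` [set t].
have hatom t : <<s mbpm_history W k >> (atom t) by exact: trajectory_history.
have matom t : measurable (atom t) by exact: mbpm_history_measurable (hatom t).
(* The null atoms arranged as a sequence: [N n] is the one whose trajectory has code n, or is
   empty. *)
pose N n := \bigcup_(t in [set t | pickle t = n /\ P (atom t) = 0%E]) atom t.
have negN : P.-negligible (\bigcup_n N n).
  apply: negligible_bigcup => n.
  case E : (unpickle n : option (seq (nvec p))) => [t|]; last first.
    rewrite (_ : N n = set0); first exact: negligible_set0.
    by apply/seteqP; split=> // w [t [tn _] _]; move: E; rewrite -tn pickleK.
  have [Pt|Pt] := pselect (P (atom t) = 0%E).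
    exists (atom t); split => // w [u [un _]].
    by move: E; rewrite -un pickleK => -[->].
  rewrite (_ : N n = set0); first exact: negligible_set0.
  apply/seteqP; split=> // w [u [un Pu] _]; apply: Pt.
  by move: E; rewrite -un pickleK => -[<-].
apply: negligibleS negN => w /= nw.
exists (pickle (trajectory k w)) => //; exists (trajectory k w) => //; split=> //.
(* By contraposition: an atom of nonzero probability yields the equality for every [A], against
   [nw]. *)
apply: contrapT => Pw0; apply: nw => A.
set a := atom (trajectory k w) in Pw0.
(* A history-measurable function is constant on the atoms. *)
have kappa_atom w' : a w' -> kappa w' A = kappa w A.
  move=> aw'; have mA : measurable A by [].
  have h := mkappa A mA measurableT [set kappa w A] (emeasurable_set1 _).
  rewrite setTI in h.
  exact: (history_saturated h (esym aw')).
have /esym := intkappa a A (hatom _) I.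
rewrite (_ : (\int[P]_(w' in a) _)%E = (kappa w A * P a)%E); last first.
  rewrite -(integral_cst P (matom _)).
  by apply: eq_integral => w' /set_mem /kappa_atom.
(* Z_k is constant on the atom, so there Z_(k+1) is a generation born from a fixed state;
   independence splits off its probability, and the nonzero factor [P a] cancels. *)
have aE : a = a `&` mbpm_process W k @^-1` [set mbpm_process W k w].
  by apply/esym/setIidPl => w' /= aw'; exact: (eq_trajectory aw').
rewrite {1}aE setI_mbpm_processS -aE next_generation_indep; last exact: hatom.
have := Pw0; rewrite -/a muleC.
have Pa_fin : P a \is a fin_num by exact: fin_num_measure (matom _).
have kA_fin : kappa w A \is a fin_num by exact: fin_num_measure.
have nA_fin : P (next_generation k (mbpm_process W k w) @^-1` A) \is a fin_num.
  apply: fin_num_measure.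
  exact: (measurable_fibers_preimage A (@next_generation_measurable k _)).
rewrite -(fineK Pa_fin) -(fineK kA_fin) -(fineK nA_fin) -!EFinM.
move=> Pa0 [] /esym eqA; congr EFin; apply: mulIf eqA.
by apply/eqP => Pa0'; apply: Pa0; rewrite Pa0'.
Qed.

End next_generation.

(** * Covariances of linear combinations of square-integrable variables *)

Section square_integrable_variables.
Context {d : measure_display} {T : measurableType d} {R : realType}.
Variable P : probability T R.
Local Open Scope ereal_scope.

Let le12 : 1 <= 2%:E :> \bar R. Proof. by rewrite lee_fin ler1n. Qed.

(** Meant for the law of the next generation, whose second moments are computed before its square
    integrability is known. *)
Lemma Lfun2_of_sqr (f : T -> R) : measurable_fun setT f ->
  \int[P]_w ((f w) ^+ 2)%:E < +oo -> f \in Lfun P 2%:E.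
Proof.
move=> mf f2; rewrite inE; apply/andP; split; rewrite inE//=.
rewrite /finite_norm unlock /Lnorm; apply: poweR_lty.
under eq_integral => w _ do
  rewrite /= powR_mulrn ?normr_ge0// real_normK ?num_real//.
exact: f2.
Qed.

Lemma expectation_integral (X : T -> R) : 'E_P[X] = \int[P]_w (X w)%:E.
Proof. by rewrite expectation.unlock. Qed.

Lemma Lfun21 (f : T -> R) : f \in Lfun P 2%:E -> f \in Lfun P 1.
Proof. exact: (Lfun_subset12 (fin_num_measure P _ measurableT)). Qed.

Lemma Lfun2_lincomb (I : Type) (r : seq I) (c : I -> R) (X : I -> T -> R) :
  (forall i, X i \in Lfun P 2%:E) ->
  (fun w => \sum_(i <- r) c i * X i w)%R \in Lfun P 2%:E.
Proof.
move=> X2; elim: r => [|i r IH].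
  by under eq_fun do rewrite big_nil; exact: Lfun_cst.
under eq_fun do rewrite big_cons.
rewrite (_ : (fun _ => _) =
  (c i \o* X i)%R \+ (fun w => \sum_(j <- r) c j * X j w)%R)%R; last first.
  by apply/funext => w /=; rewrite mulrC.
apply: (Lfun_addr_closed P le12).2 => //.
by apply: Lfun_scale; rewrite ?ler1n.
Qed.

Lemma covariance_lincombl (I : Type) (r : seq I) (c : I -> R)
    (X : I -> T -> R) (Y : T -> R) :
  (forall i, X i \in Lfun P 2%:E) -> Y \in Lfun P 2%:E ->
  covariance P (fun w => \sum_(i <- r) c i * X i w)%R Y =
  \sum_(i <- r) (c i)%:E * covariance P (X i) Y.
Proof.
move=> X2 Y2; elim: r => [|i r IH].
  by under eq_fun do rewrite big_nil; rewrite big_nil (covariance_cst_l P 0).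
under eq_fun do rewrite big_cons.
rewrite (_ : (fun _ => _) =
  (c i \o* X i)%R \+ (fun w => \sum_(j <- r) c j * X j w)%R)%R; last first.
  by apply/funext => w /=; rewrite mulrC.
rewrite covarianceDl//; last 2 first.
- by apply: Lfun_scale; rewrite ?ler1n.
- exact: Lfun2_lincomb.
rewrite covarianceZl; last exact: Lfun2_mul_Lfun1.
- by rewrite IH big_cons.
- exact: Lfun21.
- exact: Lfun21.
Qed.

Lemma covariance_fin_num2 (X Y : T -> R) : X \in Lfun P 2%:E ->
  Y \in Lfun P 2%:E -> covariance P X Y \is a fin_num.
Proof.
move=> X2 Y2; apply: covariance_fin_num; [exact: Lfun21|exact: Lfun21|].
exact: Lfun2_mul_Lfun1.
Qed.

(** Bilinearity: [covariance_lincombl] expands one argument, and symmetry transfers it to the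
    other. *)
Lemma fine_covariance_lincomb (I : Type) (r : seq I) (a b : I -> R)
    (X : I -> T -> R) :
  (forall i, X i \in Lfun P 2%:E) ->
  fine (covariance P (fun w => \sum_(i <- r) a i * X i w)%R
                     (fun w => \sum_(i <- r) b i * X i w)%R) =
  (\sum_(i <- r) \sum_(j <- r) a i * b j * fine (covariance P (X i) (X j)))%R.
Proof.
move=> X2; have b2 := Lfun2_lincomb r b X2.
have covX i : covariance P (X i) (fun w => \sum_(i <- r) b i * X i w)%R =
    (\sum_(j <- r) b j * fine (covariance P (X i) (X j)))%:E.
  rewrite covarianceC covariance_lincombl// -sumEFin; apply: eq_bigr => j _.
  by rewrite EFinM fineK ?covariance_fin_num2// covarianceC.
rewrite covariance_lincombl//.
under eq_bigr do rewrite covX -EFinM.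
rewrite sumEFin; apply: eq_bigr => i _; rewrite mulr_sumr.
by apply: eq_bigr => j _; rewrite mulrA.
Qed.

Lemma covarianceE2 (X Y : T -> R) : X \in Lfun P 2%:E -> Y \in Lfun P 2%:E ->
  fine (covariance P X Y) =
  (fine 'E_P[X * Y] - fine 'E_P[X] * fine 'E_P[Y])%R.
Proof.
move=> X2 Y2; have XY1 := Lfun2_mul_Lfun1 X2 Y2.
have EX := expectation_fin_num (Lfun21 X2).
have EY := expectation_fin_num (Lfun21 Y2).
have EXY := expectation_fin_num XY1.
rewrite covarianceE; [|exact: Lfun21|exact: Lfun21|exact: XY1].
by rewrite fineB ?fineM ?fin_numM.
Qed.

End square_integrable_variables.

(** * Moments of the offspring vectors *)

Section moments.
Context {d : measure_display} {T : measurableType d} {R : realType}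
  {P : probability T R} {p : nat}.
Variable W : mbpm P p.
Hypothesis hW : finite_moments W.

Lemma offspring_Lfun2 i a :
  (fun w => (offspring W 0 0 i w a ord0)%:R : R) \in Lfun P 2%:E.
Proof.
have [/(_ i a) + _ _ _] := hW.
by under eq_fun do rewrite /= mxE.
Qed.

Lemma integral_offspring (k j : nat) i (f : nvec p -> \bar R) :
  (forall x, 0 <= f x)%E ->
  (\int[P]_w f (offspring W k j i w) = \int[P]_w f (offspring W 0 0 i w))%E.
Proof.
move=> f0; have mf : measurable_fun setT f by [].
rewrite -(ge0_integral_distribution (offspring W k j i) mf f0) offspring_id.
exact: ge0_integral_distribution.
Qed.

Lemma integral_migration k z (f : zvec p -> \bar R) : (forall x, 0 <= f x)%E ->
  (\int[P]_w f (migration W k z w) = \int[P]_w f (migration W 0 z w))%E.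
Proof.
move=> f0; have mf : measurable_fun setT f by [].
rewrite -(ge0_integral_distribution (migration W k z) mf f0) migration_id.
exact: ge0_integral_distribution.
Qed.

(* E[X_(u,a) X_(v,b)] for two individuals u and v, labelled (type, number), of
   one generation. *)
Definition offspring_moment2 (u v : 'I_p * nat) (a b : 'I_p) : R :=
  if u == v then fine 'E_P[fun w => (offspring W 0 0 u.1 w a ord0)%:R *
                                    (offspring W 0 0 u.1 w b ord0)%:R]
  else offspring_mean W a u.1 * offspring_mean W b v.1.

Lemma integral_offspring1 k j i a :
  (\int[P]_w ((offspring W k j i w a ord0)%:R)%:E =
   (offspring_mean W a i)%:E)%E.
Proof.
rewrite (integral_offspring k j i (f := fun x => ((x a ord0)%:R)%:E)).
  rewrite /offspring_mean !mxE -[LHS]fineK.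
    by congr (EFin (fine _)); rewrite unlock; apply: eq_integral => w _;
      rewrite /= mxE.
  have := expectation_fin_num (Lfun21 (offspring_Lfun2 i a)).
  by rewrite unlock.
by move=> x; rewrite lee_fin.
Qed.

Lemma offspring_mean_ge0 a i : 0 <= offspring_mean W a i.
Proof.
rewrite -lee_fin -(integral_offspring1 0 0).
by apply: integral_ge0 => w _; rewrite lee_fin.
Qed.

Lemma offspring_moment2_ge0 u v a b : 0 <= offspring_moment2 u v a b.
Proof.
rewrite /offspring_moment2; case: eqP => _.
  by rewrite fine_ge0// expectation_ge0.
by rewrite mulr_ge0// offspring_mean_ge0.
Qed.

Lemma integral_offspring2 k j i a b :
  (\int[P]_w ((offspring W k j i w a ord0)%:R *
              (offspring W k j i w b ord0)%:R)%:E =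
   (offspring_moment2 (i, j) (i, j) a b)%:E)%E.
Proof.
rewrite (integral_offspring k j i
  (f := fun x => ((x a ord0)%:R * (x b ord0)%:R)%:E)).
  rewrite /offspring_moment2 eqxx -[LHS]fineK; first by rewrite unlock.
  have := expectation_fin_num
    (Lfun2_mul_Lfun1 (offspring_Lfun2 i a) (offspring_Lfun2 i b)).
  by rewrite unlock.
by move=> x; rewrite lee_fin mulr_ge0.
Qed.

(** The number 0 is an arbitrary representative: on the diagonal [offspring_moment2] depends on the
    type only. *)
Lemma offspring_covE i a b : offspring_cov W i a b =
  offspring_moment2 (i, 0%N) (i, 0%N) a b -
  offspring_mean W a i * offspring_mean W b i.
Proof.
rewrite /offspring_moment2 eqxx /offspring_mean !mxE.
have natE c : (fun w => (nvecR R \o offspring W 0 0 i) w c ord0) =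
    (fun w => (offspring W 0 0 i w c ord0)%:R).
  by apply/funext => w; rewrite /= mxE.
by rewrite !natE covarianceE2 ?offspring_Lfun2.
Qed.

Lemma measurable_fibers_offspring k j i : measurable_fibers (offspring W k j i).
Proof. by move=> x; exact: measurable_funPTI. Qed.

Lemma measurable_fibers_migration k z : measurable_fibers (migration W k z).
Proof. by move=> x; exact: measurable_funPTI. Qed.

(** * Independence of migration and offspring within one generation *)

Lemma offspring_source k j i (A : set (nvec p)) (J : pred (mbpm_index p)) :
  J (inl (inr (k, j, i))) ->
  <<s block (source_sigma W) J >> (offspring W k j i @^-1` A).
Proof.
move=> Jx; apply: sub_sigma_algebra; exists (inl (inr (k, j, i))) => //=.
by exists A => //; rewrite setTI.
Qed.

Lemma migration_source k z (A : set (zvec p)) (J : pred (mbpm_index p)) :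
  J (inr (k, z)) ->
  <<s block (source_sigma W) J >> (migration W k z @^-1` A).
Proof.
move=> Jx; apply: sub_sigma_algebra; exists (inr (k, z)) => //=.
by exists A => //; rewrite setTI.
Qed.

Lemma indep_sources (J1 J2 : pred (mbpm_index p)) (A B : set T) :
  (forall x, J1 x -> ~~ J2 x) ->
  <<s block (source_sigma W) J1 >> A -> <<s block (source_sigma W) J2 >> B ->
  P (A `&` B) = (P A * P B)%E.
Proof.
exact: (indep_blocks (@source_sigma_measurable _ _ _ _ _ W)
  (@source_sigma_setT _ _ _ _ _ W) (@source_sigma_setI _ _ _ _ _ W)
  (@mbpm_indep _ _ _ _ _ W)).
Qed.

Lemma migration_offspring_indep k z j i (C : set (zvec p)) (A : set (nvec p)) :
  P (migration W k z @^-1` C `&` offspring W k j i @^-1` A) =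
  (P (migration W k z @^-1` C) * P (offspring W k j i @^-1` A))%E.
Proof.
apply: (@indep_sources (pred1 (inr (k, z))) (pred1 (inl (inr (k, j, i))))).
- by move=> x /= /eqP ->.
- by apply: migration_source => /=.
- by apply: offspring_source => /=.
Qed.

(** Migration and the first individual form one block, the second individual another; [u != v] makes
    them disjoint. *)
Lemma migration_offspring2_indep k z (u v : 'I_p * nat) (C : set (zvec p))
    (A B : set (nvec p)) : u != v ->
  P (migration W k z @^-1` C `&` offspring W k u.2 u.1 @^-1` A `&`
     offspring W k v.2 v.1 @^-1` B) =
  (P (migration W k z @^-1` C `&` offspring W k u.2 u.1 @^-1` A) *
   P (offspring W k v.2 v.1 @^-1` B))%E.
Proof.
move=> uv; apply: (@indep_sources
  (pred2 (inr (k, z)) (inl (inr (k, u.2, u.1))))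
  (pred1 (inl (inr (k, v.2, v.1))))).
- move=> x /= /orP[] /eqP -> //; apply: contra uv => /eqP[eq2 eq1].
  by rewrite [u]surjective_pairing [v]surjective_pairing eq1 eq2.
- apply: (@measurableI _ (source_space W _)).
  + by apply: migration_source => /=; rewrite eqxx.
  + by apply: offspring_source => /=; rewrite ?eqxx ?orbT.
- by apply: offspring_source => /=.
Qed.

Lemma integral_migration_offspring k z (C : set (zvec p)) (u : 'I_p * nat) a :
  (\int[P]_(w in migration W k z @^-1` C)
     ((offspring W k u.2 u.1 w a ord0)%:R)%:E =
   P (migration W k z @^-1` C) * (offspring_mean W a u.1)%:E)%E.
Proof.
rewrite (integral_indep (X := offspring W k u.2 u.1)
  (f := fun x => (x a ord0)%:R)) ?integral_offspring1//.
- exact: measurable_fibers_offspring.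
- exact: measurable_fibers_preimage (@measurable_fibers_migration k z).
- by move=> x; exact: migration_offspring_indep.
Qed.

(** Equal individuals share one vector, which gives its second moment; distinct ones are
    independent, which gives a product of means. *)
Lemma integral_migration_offspring2 k z (C : set (zvec p)) (u v : 'I_p * nat)
    a b :
  (\int[P]_(w in migration W k z @^-1` C)
     ((offspring W k u.2 u.1 w a ord0)%:R *
      (offspring W k v.2 v.1 w b ord0)%:R)%:E =
   P (migration W k z @^-1` C) * (offspring_moment2 u v a b)%:E)%E.
Proof.
have mC : measurable (migration W k z @^-1` C).
  exact: measurable_fibers_preimage (@measurable_fibers_migration k z).
have [<-|uv] := eqVneq u v.
  rewrite (integral_indep (X := offspring W k u.2 u.1)
    (f := fun x => (x a ord0)%:R * (x b ord0)%:R))//.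
  - by rewrite integral_offspring2 -surjective_pairing.
  - exact: measurable_fibers_offspring.
  - by move=> x; exact: migration_offspring_indep.
rewrite (integral_indep2 (X := offspring W k u.2 u.1)
  (Y := offspring W k v.2 v.1) (f := fun x => (x a ord0)%:R)
  (g := fun x => (x b ord0)%:R))//.
- by rewrite !integral_offspring1 /offspring_moment2 (negPf uv) EFinM.
- exact: measurable_fibers_offspring.
- exact: measurable_fibers_offspring.
- by move=> x; exact: migration_offspring_indep.
- by move=> x y; exact: migration_offspring2_indep.
Qed.

(** * Sums over the individuals of a generation *)

Definition individuals (n : nvec p) : seq ('I_p * nat) :=
  [seq (i, j) | i <- enum 'I_p, j <- iota 0 (n i ord0)].

Lemma individuals_uniq n : uniq (individuals n).
Proof.
apply: allpairs_uniq_dep => [|i _|]; rewrite ?enum_uniq ?iota_uniq//.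
by move=> [i j] [i' j'] _ _ /= [-> ->].
Qed.

Lemma sum_individuals (V : nmodType) (n : nvec p) (F : 'I_p * nat -> V) :
  \sum_(u <- individuals n) F u =
  \sum_(i < p) \sum_(j < n i ord0) F (i, val j).
Proof.
rewrite big_allpairs_dep big_enum/=; apply: eq_bigr => i _.
by rewrite -(big_mkord xpredT (fun j => F (i, j))) /index_iota subn0.
Qed.

Lemma offspring_totalE k n w a : offspring_total W k n w a ord0 =
  (\sum_(u <- individuals n) offspring W k u.2 u.1 w a ord0)%N.
Proof.
rewrite sum_individuals /offspring_total summxE; apply: eq_bigr => i _.
by rewrite summxE.
Qed.

Lemma sum_individuals_mean n (f : 'I_p -> R) :
  \sum_(u <- individuals n) f u.1 = \sum_(i < p) f i * (n i ord0)%:R.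
Proof.
rewrite sum_individuals; apply: eq_bigr => i _ /=.
by rewrite sumr_const card_ord mulr_natr.
Qed.

(** Were every pair independent, the double sum would be the product of the sums of means; each
    diagonal pair differs from that by a covariance entry of its type. *)
Lemma sum_offspring_moment2 n a b :
  \sum_(u <- individuals n) \sum_(v <- individuals n) offspring_moment2 u v a b =
  (\sum_(i < p) offspring_mean W a i * (n i ord0)%:R) *
  (\sum_(i < p) offspring_mean W b i * (n i ord0)%:R) +
  \sum_(i < p) offspring_cov W i a b * (n i ord0)%:R.
Proof.
rewrite -!sum_individuals_mean mulr_suml -big_split/= big_seq [RHS]big_seq.
apply: eq_bigr => u un; rewrite mulr_sumr.
(* The list has no repetition, so exactly one v pairs with u on the diagonal. *)
rewrite !(bigD1_seq u un (individuals_uniq n))/=.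
rewrite [RHS]addrAC; congr (_ + _).
  by rewrite offspring_covE addrC subrK /offspring_moment2 !eqxx.
by apply: eq_bigr => v; rewrite eq_sym /offspring_moment2 => /negPf ->.
Qed.

(** The population is frozen at [n]; [C] is later taken to be the event that the population equals
    [n]. *)
Lemma integral_offspring_total k z (C : set (zvec p)) n a :
  (\int[P]_(w in migration W k z @^-1` C)
     ((offspring_total W k n w a ord0)%:R)%:E =
   P (migration W k z @^-1` C) *
     (\sum_(u <- individuals n) offspring_mean W a u.1)%:E)%E.
Proof.
have mC : measurable (migration W k z @^-1` C).
  exact: measurable_fibers_preimage (@measurable_fibers_migration k z).
under eq_integral do rewrite offspring_totalE natr_sum -sumEFin.
rewrite ge0_integral_sum//; last first.
  move=> u; apply: measurable_funTS.
  exact: (@measurable_fibers_fun _ _ _ _ _ _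
    (fun x : nvec p => ((x a ord0)%:R : R)%:E)
    (@measurable_fibers_offspring k u.2 u.1)).
rewrite -sumEFin ge0_sume_distrr; last first.
  by move=> u _; rewrite lee_fin offspring_mean_ge0.
by apply: eq_bigr => u _; rewrite integral_migration_offspring.
Qed.

Lemma integral_offspring_total2 k z (C : set (zvec p)) n a b :
  (\int[P]_(w in migration W k z @^-1` C)
     ((offspring_total W k n w a ord0)%:R *
      (offspring_total W k n w b ord0)%:R)%:E =
   P (migration W k z @^-1` C) *
     (\sum_(u <- individuals n) \sum_(v <- individuals n)
        offspring_moment2 u v a b)%:E)%E.
Proof.
have mC : measurable (migration W k z @^-1` C).
  exact: measurable_fibers_preimage (@measurable_fibers_migration k z).
pose X u c w : R := (offspring W k u.2 u.1 w c ord0)%:R.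
have mX u c : measurable_fun setT (X u c).
  exact: (@measurable_fibers_fun _ _ _ _ _ _
    (fun x : nvec p => (x c ord0)%:R : R)
    (@measurable_fibers_offspring k u.2 u.1)).
have mXX u v : measurable_fun setT (fun w => (X u a w * X v b w)%:E).
  by apply/measurable_EFinP; exact: measurable_funM.
have XX0 u v w : (0 <= (X u a w * X v b w)%:E)%E by rewrite lee_fin mulr_ge0.
transitivity (\int[P]_(w in migration W k z @^-1` C)
    (\sum_(u <- individuals n) \sum_(v <- individuals n)
      (X u a w * X v b w)%:E))%E.
  apply: eq_integral => w _; rewrite !offspring_totalE !natr_sum mulr_suml.
  by rewrite -sumEFin; apply: eq_bigr => u _; rewrite mulr_sumr -sumEFin.
rewrite ge0_integral_sum//; last 2 first.
- by move=> u; apply: measurable_funTS; exact: emeasurable_sum.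
- by move=> u w _; exact: sume_ge0.
rewrite -sumEFin ge0_sume_distrr; last first.
  by move=> u _; rewrite lee_fin sumr_ge0// => v _; exact: offspring_moment2_ge0.
apply: eq_bigr => u _; rewrite ge0_integral_sum//; last first.
  by move=> v; exact: measurable_funTS.
rewrite -sumEFin ge0_sume_distrr; last first.
  by move=> v _; rewrite lee_fin offspring_moment2_ge0.
by apply: eq_bigr => v _; rewrite integral_migration_offspring2.
Qed.

(** Where the population after migration equals n, the next generation is [offspring_total W k n],
    so [fg] with that event as [C] replaces [f] by [g]. *)
Lemma integral_next_generation k z (f g : nvec p -> R) :
  (forall n, 0 <= f n) -> (forall n, 0 <= g n) ->
  (forall C n, \int[P]_(w in migration W k z @^-1` C)
                 (f (offspring_total W k n w))%:E =
               P (migration W k z @^-1` C) * (g n)%:E)%E ->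
  (\int[P]_w (f (next_generation W k z w))%:E =
   \int[P]_w (g (population z (migration W 0 z w)))%:E)%E.
Proof.
move=> f0 g0 fg.
(* Equality in law moves the right-hand side to step k, so that both sides involve the same
   migration vector. *)
rewrite -(integral_migration k z (f := fun m => (g (population z m))%:E));
  last by move=> m; rewrite lee_fin.
have mN : measurable_fibers (fun w => population z (migration W k z w)).
  exact: (measurable_fibers_comp (population z)
    (@measurable_fibers_migration k z)).
apply: (@eq_integral_fibers _ _ _ _ _
  (fun w => population z (migration W k z w))) => //.
- exact: (@measurable_fibers_fun _ _ _ _ _ _ (EFin \o f)
    (@next_generation_measurable _ _ _ _ _ W k z)).
- exact: (@measurable_fibers_fun _ _ _ _ _ _ (EFin \o g) mN).
- by move=> w; rewrite lee_fin.
- by move=> w; rewrite lee_fin.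
move=> n; rewrite setTI.
transitivity (\int[P]_(w in migration W k z @^-1` (population z @^-1` [set n]))
    (f (offspring_total W k n w))%:E)%E.
  by apply: eq_integral => w /set_mem /= nw; rewrite /next_generation nw.
rewrite fg.
transitivity (\int[P]_(w in migration W k z @^-1` (population z @^-1` [set n]))
    (g n)%:E)%E; last first.
  by apply: eq_integral => w /set_mem /= nw; rewrite nw.
by rewrite [RHS](integral_cst P (mN n)) muleC.
Qed.

(** * Moments of the population after migration and of the next generation *)

Let Nr z i w : R := (population z (migration W 0 z w) i ord0)%:R.

Let NrE z i w :
  Nr z i w = (z i ord0)%:R + (migration W 0 z w i ord0)%:~R.
Proof.
(* Emigration never exceeds the current state, by [migration_ge], so the absolute value
   disappears. *)
rewrite /Nr /population mxE natr_absz ger0_norm; last first.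
  by rewrite addrC -[X in _ + X]opprK subr_ge0 migration_ge.
by rewrite intrD.
Qed.

Let migration_Lfun2 z i :
  (fun w => (migration W 0 z w i ord0)%:~R : R) \in Lfun P 2%:E.
Proof.
have [_ /(_ z i) + _ _] := hW.
by under eq_fun do rewrite /= mxE.
Qed.

Let Nr_Lfun2 z i : Nr z i \in Lfun P 2%:E.
Proof.
rewrite (_ : Nr z i = cst (z i ord0)%:R \+
  (fun w => (migration W 0 z w i ord0)%:~R)); last by apply/funext => w; rewrite NrE.
apply: (Lfun_addr_closed P _).2 => //; last exact: Lfun_cst.
by rewrite lee_fin ler1n.
Qed.

Let expectation_Nr z i :
  fine 'E_P[Nr z i] = (nvecR R z + migration_mean W z) i ord0.
Proof.
rewrite (_ : Nr z i = cst (z i ord0)%:R \+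
  (fun w => (migration W 0 z w i ord0)%:~R)); last by apply/funext => w; rewrite NrE.
have M1 := Lfun21 (migration_Lfun2 z i).
rewrite expectationD ?Lfun_cst// fineD ?expectation_fin_num ?Lfun_cst//.
rewrite expectation_cst !mxE /=; congr (_ + fine _).
by congr expectation; apply/funext => w; rewrite /= mxE.
Qed.

(** The state z is a deterministic shift and drops out of the covariance. *)
Let covariance_Nr z i j :
  fine (covariance P (Nr z i) (Nr z j)) = migration_cov W z i j.
Proof.
have NrD l : Nr z l = cst (z l ord0)%:R \+
  (fun w => (migration W 0 z w l ord0)%:~R) by apply/funext => w; rewrite NrE.
rewrite NrD covarianceDl ?Nr_Lfun2 ?Lfun_cst ?migration_Lfun2//.
rewrite covariance_cst_l add0e NrD covarianceDr ?Lfun_cst ?migration_Lfun2//.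
rewrite covariance_cst_r add0e mxE.
by congr (fine (covariance _ _ _)); apply/funext => w; rewrite /= mxE.
Qed.

(** Entry a of m N, the mean of the next generation once migration is known. *)
Let mean_Nr z a w := \sum_(i < p) offspring_mean W a i * Nr z i w.

Lemma next_generation_moment1 k z a :
  (\int[P]_w ((next_generation W k z w a ord0)%:R)%:E = 'E_P[mean_Nr z a])%E.
Proof.
rewrite (integral_next_generation (f := fun x => (x a ord0)%:R)
  (g := fun n => \sum_(u <- individuals n) offspring_mean W a u.1))//.
- by rewrite expectation_integral; apply: eq_integral => w _; rewrite sum_individuals_mean.
- by move=> n; apply: sumr_ge0 => u _; exact: offspring_mean_ge0.
- by move=> C n; exact: integral_offspring_total.
Qed.

(** The law of total covariance before means are subtracted: the product carries the randomness of
    migration, the sum that of reproduction. *)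
Lemma next_generation_moment2 k z a b :
  (\int[P]_w ((next_generation W k z w a ord0)%:R *
              (next_generation W k z w b ord0)%:R)%:E =
   'E_P[(mean_Nr z a \* mean_Nr z b \+
         (fun w => \sum_(i < p) offspring_cov W i a b * Nr z i w))%R])%E.
Proof.
rewrite (integral_next_generation
  (f := fun x => (x a ord0)%:R * (x b ord0)%:R)
  (g := fun n => \sum_(u <- individuals n) \sum_(v <- individuals n)
     offspring_moment2 u v a b))//.
- by rewrite expectation_integral; apply: eq_integral => w _; rewrite sum_offspring_moment2.
- move=> n; apply: sumr_ge0 => u _; apply: sumr_ge0 => v _.
  exact: offspring_moment2_ge0.
- by move=> C n; exact: integral_offspring_total2.
Qed.

Lemma expectation_lincomb_Nr z (c : 'I_p -> R) :
  fine 'E_P[fun w => \sum_(i < p) c i * Nr z i w] =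
  \sum_(i < p) c i * (nvecR R z + migration_mean W z) i ord0.
Proof.
pose r := index_enum 'I_p; rewrite -/r; elim: r => [|i r IH].
  by under eq_fun do rewrite big_nil; rewrite big_nil (expectation_cst P 0).
under eq_fun do rewrite big_cons.
rewrite (_ : (fun _ => _) =
  (c i \o* Nr z i) \+ (fun w => \sum_(j <- r) c j * Nr z j w)); last first.
  by apply/funext => w /=; rewrite mulrC.
have N1 := Lfun21 (Nr_Lfun2 z i).
have cN1 : c i \o* Nr z i \in Lfun P 1 by exact: Lfun_scale.
have r1 := Lfun21 (Lfun2_lincomb r c (Nr_Lfun2 z)).
rewrite expectationD// fineD ?expectation_fin_num// IH big_cons.
by rewrite expectationZl// fineM ?expectation_fin_num// expectation_Nr.
Qed.

(** * Mean and covariance of the law of the next generation *)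

Section next_generation_law.
(** [nu] stays abstract because it will be the value, at a sample point, of an arbitrary version of
    the conditional law. *)
Variables (k : nat) (z : nvec p) (nu : probability (nvec p) R).
Hypothesis nuE : forall A, nu A = P (next_generation W k z @^-1` A).

Let entry a (x : nvec p) : R := (x a ord0)%:R.

Let nvecR_entry a : (fun x : nvec p => nvecR R x a ord0) = entry a.
Proof. by apply/funext => x; rewrite mxE. Qed.

Let integral_nu (f : nvec p -> \bar R) : (forall x, 0 <= f x)%E ->
  (\int[nu]_x f x = \int[P]_w f (next_generation W k z w))%E.
Proof.
move=> f0; have mf : measurable_fun setT f by [].
rewrite -(ge0_integral_distribution (next_generation W k z) mf f0).
by apply: eq_measure_integral => A _ _; exact: nuE.
Qed.

Let mean_Lfun2 a : mean_Nr z a \in Lfun P 2%:E.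
Proof. exact: Lfun2_lincomb (Nr_Lfun2 z). Qed.

Let cov_Lfun1 a b :
  (fun w => \sum_(i < p) offspring_cov W i a b * Nr z i w) \in Lfun P 1.
Proof. exact: Lfun21 (Lfun2_lincomb _ _ (Nr_Lfun2 z)). Qed.

Let expectation_entry a : ('E_nu[entry a] = 'E_P[mean_Nr z a])%E.
Proof.
rewrite -(next_generation_moment1 k) [LHS]expectation_integral.
by rewrite integral_nu// => x; rewrite lee_fin.
Qed.

Let expectation_entry2 a b : ('E_nu[(entry a * entry b)%R] =
  'E_P[(mean_Nr z a \* mean_Nr z b)%R] +
  'E_P[(fun w => \sum_(i < p) offspring_cov W i a b * Nr z i w)%R])%E.
Proof.
rewrite -expectationD ?cov_Lfun1 ?Lfun2_mul_Lfun1//.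
rewrite -(next_generation_moment2 k) [LHS]expectation_integral.
by rewrite integral_nu// => x; rewrite lee_fin mulr_ge0.
Qed.

(** Nonnegativity alone gave [expectation_entry2]; its right-hand side is finite, whence square
    integrability. *)
Let entry_Lfun2 a : entry a \in Lfun nu 2%:E.
Proof.
apply: Lfun2_of_sqr => //.
rewrite (_ : (\int[nu]_x _)%E = 'E_nu[(entry a * entry a)%R]%E); last first.
  by rewrite expectation_integral; apply: eq_integral => x _; rewrite expr2.
rewrite expectation_entry2 ltey_eq fin_numD !expectation_fin_num//.
exact: Lfun2_mul_Lfun1.
Qed.

Lemma next_generation_square_integrable : square_integrable nu (nvecR R).
Proof. by move=> a; rewrite nvecR_entry. Qed.

Lemma next_generation_mean : mean_vec nu (nvecR R) =
  offspring_mean W *m (nvecR R z + migration_mean W z).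
Proof.
apply/colP => a; rewrite !mxE nvecR_entry expectation_entry.
exact: expectation_lincomb_Nr.
Qed.

Lemma next_generation_cov : cov_mx nu (nvecR R) =
  odot (nvecR R z + migration_mean W z) (offspring_cov W) +
  offspring_mean W *m migration_cov W z *m (offspring_mean W)^T.
Proof.
apply/matrixP => a b; rewrite mxE !nvecR_entry covarianceE2//.
rewrite expectation_entry2 !expectation_entry fineD; last 2 first.
- by apply: expectation_fin_num; exact: Lfun2_mul_Lfun1.
- exact: expectation_fin_num.
(* The product moment minus the product of means is the covariance of two entries of m N; the
   remaining expectation is linear in N. *)
rewrite addrAC -covarianceE2// fine_covariance_lincomb//.
rewrite expectation_lincomb_Nr mxE addrC; congr (_ + _).
  by rewrite /odot summxE; apply: eq_bigr => i _; rewrite !mxE mulrC.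
(* In the triple matrix product the outer sum runs over the column index of the migration
   covariance. *)
rewrite !mxE exchange_big; apply: eq_bigr => j _; rewrite !mxE mulr_suml.
apply: eq_bigr => i _; rewrite covariance_Nr mulrAC.
by [].
Qed.

End next_generation_law.

End moments.

Unset Implicit Arguments.
Set Strict Implicit.

Theorem proposition1 (d : measure_display) (T : measurableType d)
    (R : realType) (P : probability T R) (p : nat) (hp : (0 < p)%N)
    (W : mbpm P p) (hW : finite_moments W) (k : nat) :
  (exists kappa : T -> probability (nvec p) R,
     is_cond_distribution P (mbpm_history W k) (mbpm_process W k.+1) kappa) /\
  (forall kappa : T -> probability (nvec p) R,
     is_cond_distribution P (mbpm_history W k) (mbpm_process W k.+1) kappa ->
     {ae P, forall w,
        let z := mbpm_process W k w in
        [/\ square_integrable (kappa w) (nvecR R),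
            mean_vec (kappa w) (nvecR R) =
              offspring_mean W *m (nvecR R z + migration_mean W z) &
            cov_mx (kappa w) (nvecR R) =
              odot (nvecR R z + migration_mean W z) (offspring_cov W) +
              offspring_mean W *m migration_cov W z *m (offspring_mean W)^T]}).
Proof.
split; first by eexists; exact: mbpm_cond_distribution.
move=> kappa hkappa.
(* Almost surely [kappa w] is the law of the generation born from Z_k(w); at such a w the three
   claims hold pointwise. *)
apply: filterS (cond_distribution_unique hkappa) => w kappaE.
split.
- exact: (next_generation_square_integrable hW kappaE).
- exact: (next_generation_mean hW kappaE).
- exact: (next_generation_cov hW kappaE).
Qed.
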